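(* Let $\ell^{OI}$ be a line in a Desargues affine plane, with its skew field structure $(\ell^{OI},+,\cdot)$ given by addition and multiplication of points, and let $B,C,D\in\ell^{OI}$ be fixed. Let $\mathcal{R}^{A}_4=\{\mu(X)=c_r(X,B;C,D)\mid X\in\ell^{OI}\}$, where $c_r(X,B;C,D)=[(X-D)^{-1}(B-D)][(B-C)^{-1}(X-C)]$. Then for any three elements $\mu(X),\mu(Y),\mu(Z)$ of $\mathcal{R}^{A}_4$: (1) $\mu(X)\cdot[\mu(Y)+\mu(Z)]=\mu(X)\cdot\mu(Y)+\mu(X)\cdot\mu(Z)$; and (2) $[\mu(X)+\mu(Y)]\cdot\mu(Z)=\mu(X)\cdot\mu(Z)+\mu(Y)\cdot\mu(Z)$.
   Context: A Desargues affine plane is an affine plane (two distinct points lie on exactly one line; through a point $P$ not on a line $\ell$ passes exactly one line disjoint from $\ell$; there are three non-collinear points) satisfying Desargues' axiom: if $\ell^{AA'},\ell^{BB'},\ell^{CC'},\ell^{AC},\ell^{A'C'}$ are pairwise distinct lines such that $\ell^{AA'},\ell^{BB'},\ell^{CC'}$ are all parallel or all meet in one point $P$, and if $\ell^{AB}\parallel\ell^{A'B'}$, $\ell^{BC}\parallel\ell^{B'C'}$, $A\ne C$, $A'\ne C'$, $\ell^{AB}\ne\ell^{A'B'}$, $\ell^{BC}\ne\ell^{B'C'}$, then $\ell^{AC}\parallel\ell^{A'C'}$. Here $\ell^{PQ}$ is the line through $P,Q$, and $\ell^{R}_{PQ}$ is the line through $R$ parallel to $\ell^{PQ}$. Fix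 a line $\ell^{OI}$ through two distinct points $O,I$. For $A,B\in\ell^{OI}$ and an auxiliary point $B_1\notin\ell^{OI}$: addition: $P_1=\ell^{B_1}_{OI}\cap\ell^{A}_{OB_1}$ and $A+B=\ell^{P_1}_{BB_1}\cap\ell^{OI}$; multiplication: $P_1=\ell^{A}_{IB_1}\cap\ell^{OB_1}$ and $A\cdot B=\ell^{P_1}_{BB_1}\cap\ell^{OI}$. It is known that $(\ell^{OI},+,\cdot)$ is a skew field (division ring) with zero $O$ and unit $I$. Cross-ratio: for four points $A,B,C,D\in\ell^{OI}$, no three of them equal, $c_r(A,B;C,D)=[(A-D)^{-1}(B-D)][(B-C)^{-1}(A-C)]$, computed in this skew field. The paper writes the cross-ratio for all $X\in\ell^{OI}$ and gives no separate convention for a value of $X$ at which an inverse of $O$ would occur. *)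

(* Defs.v *)
From Stdlib Require Import List Classical ClassicalEpsilon.
Import ListNotations.

(* Lines form an abstract type with an incidence relation.  The axioms force
   every line to carry at least two points, so a line is determined by its set
   of points. *)
Record affine_plane := AffinePlane {
  point : Type;
  line : Type;
  on : point -> line -> Prop;
  join_axiom : forall P Q : point, P <> Q ->
    exists! l : line, on P l /\ on Q l;
  parallel_axiom : forall (P : point) (l : line), ~ on P l ->
    exists! m : line, on P m /\ ~ (exists Q : point, on Q m /\ on Q l);
  triangle_axiom : exists A B C : point,
    A <> B /\ A <> C /\ B <> C /\ ~ (exists l : line, on A l /\ on B l /\ on C l)
}.

Arguments on {_} _ _.

Lemma point_inhabited (p : affine_plane) : inhabited (point p).
Proof. destruct (triangle_axiom p) as [A _]; exact (inhabits A). Qed.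

Lemma line_inhabited (p : affine_plane) : inhabited (line p).
Proof.
destruct (triangle_axiom p) as [A [B [_ [hAB _]]]].
destruct (join_axiom p _ _ hAB) as [l _]; exact (inhabits l).
Qed.

Definition parallel {p : affine_plane} (l m : line p) : Prop :=
  l = m \/ ~ (exists Q : point p, on Q l /\ on Q m).

(* Meaningful only when P <> Q. *)
Definition line_through {p : affine_plane} (P Q : point p) : line p :=
  epsilon (line_inhabited p) (fun l => on P l /\ on Q l).

Definition parallel_through {p : affine_plane} (R : point p) (l : line p) :
    line p :=
  epsilon (line_inhabited p) (fun m => on R m /\ parallel m l).

(* Meaningful only when l and m are not parallel. *)
Definition meet {p : affine_plane} (l m : line p) : point p :=
  epsilon (point_inhabited p) (fun P => on P l /\ on P m).

(* The inequalities up to [B' <> C'] say that every line written with two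
   points in the axiom is really determined by them. *)
Definition Desargues (p : affine_plane) : Prop :=
  forall A B C A' B' C' : point p,
    A <> A' -> B <> B' -> C <> C' ->
    A <> C -> A' <> C' ->
    A <> B -> A' <> B' -> B <> C -> B' <> C' ->
    NoDup [line_through A A'; line_through B B'; line_through C C';
           line_through A C; line_through A' C'] ->
    (parallel (line_through A A') (line_through B B') /\
     parallel (line_through B B') (line_through C C') /\
     parallel (line_through A A') (line_through C C')
     \/
     exists P : point p, on P (line_through A A') /\
       on P (line_through B B') /\ on P (line_through C C')) ->
    parallel (line_through A B) (line_through A' B') ->
    parallel (line_through B C) (line_through B' C') ->
    line_through A B <> line_through A' B' ->
    line_through B C <> line_through B' C' ->
    parallel (line_through A C) (line_through A' C').

Definition add_via {p : affine_plane} (O I B1 A B : point p) : point p :=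
  let OI := line_through O I in
  let P1 := meet (parallel_through B1 OI)
                 (parallel_through A (line_through O B1)) in
  meet (parallel_through P1 (line_through B B1)) OI.

Definition mul_via {p : affine_plane} (O I B1 A B : point p) : point p :=
  let P1 := meet (parallel_through A (line_through I B1))
                 (line_through O B1) in
  meet (parallel_through P1 (line_through B B1)) (line_through O I).

(* The auxiliary point may be a different one for each pair of operands. *)
Definition padd {p : affine_plane} (O I A B : point p) : point p :=
  epsilon (point_inhabited p) (fun S => exists B1 : point p,
    ~ on B1 (line_through O I) /\ S = add_via O I B1 A B).

Definition pmul {p : affine_plane} (O I A B : point p) : point p :=
  epsilon (point_inhabited p) (fun S => exists B1 : point p,
    ~ on B1 (line_through O I) /\ S = mul_via O I B1 A B).

(* A point of l satisfying P when there is one, otherwise an unspecified point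
   of l. *)
Definition choose_on {p : affine_plane} (l : line p) (P : point p -> Prop) :
    point p :=
  epsilon (point_inhabited p)
    (fun X => on X l /\ ((exists Y : point p, on Y l /\ P Y) -> P X)).

Definition popp {p : affine_plane} (O I A : point p) : point p :=
  choose_on (line_through O I) (fun X => padd O I A X = O /\ padd O I X A = O).

(* Only O has no inverse; its value is then an unspecified point of the line OI. *)
Definition pinv {p : affine_plane} (O I A : point p) : point p :=
  choose_on (line_through O I) (fun X => pmul O I A X = I /\ pmul O I X A = I).

Definition psub {p : affine_plane} (O I A B : point p) : point p :=
  padd O I A (popp O I B).

Declare Scope plane_scope.
Notation "A +[ O , I ] B" := (padd O I A B)
  (at level 50, left associativity) : plane_scope.
Notation "A -[ O , I ] B" := (psub O I A B)
  (at level 50, left associativity) : plane_scope.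
Notation "A *[ O , I ] B" := (pmul O I A B)
  (at level 40, left associativity) : plane_scope.

Open Scope plane_scope.

(* c_r(A,B;C,D).  The restriction to quadruples with no three equal points is
   left out: the expression is a point of OI for all A, B, C, D on OI. *)
Definition cross_ratio {p : affine_plane} (O I A B C D : point p) : point p :=
  (pinv O I (A -[O, I] D) *[O, I] (B -[O, I] D))
  *[O, I]
  (pinv O I (B -[O, I] C) *[O, I] (A -[O, I] C)).

Definition R4A {p : affine_plane} (O I B C D : point p) (M : point p) : Prop :=
  exists X : point p, on X (line_through O I) /\ M = cross_ratio O I X B C D.

(* Main.v *)
(** A map f of the plane is called a dilatation when the line f(X) f(Y) is
    always parallel to XY; such a map is determined by its values at two points.
    Desargues' axiom yields the homotheties h_A fixing O with h_A(I) = A, and,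
    as soon as lines have three points, the translations t_A with t_A(O) = A.
    Reading the two point constructions as images of the auxiliary point under
    t_A and h_A gives A + B = t_A(B) and A.B = h_A(B), whatever the auxiliary
    point.  The left law is then h_A t_B = t_(A.B) h_A, and the right law holds
    because X |-> t_(h_A(X)) (h_B(X)) is again a dilatation.  The elements of
    R4A enter only as points of OI. *)

From Stdlib Require Import List Classical ClassicalEpsilon IndefiniteDescription.
Import ListNotations.
Require Import Defs.

Section Plane.

Variable p : affine_plane.
Implicit Types (P Q R S X Y Z : point p) (l m n : line p).

(** * Incidence, parallel classes and intersections *)

Lemma line_eq P Q l m :
  P <> Q -> on P l -> on Q l -> on P m -> on Q m -> l = m.
Proof.
intros hPQ h1 h2 h3 h4.
destruct (join_axiom p P Q hPQ) as [k [_ hk]].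
rewrite <- (hk l), <- (hk m); auto.
Qed.

Lemma line_through_spec P Q :
  P <> Q -> on P (line_through P Q) /\ on Q (line_through P Q).
Proof.
intros hPQ; unfold line_through; apply epsilon_spec.
destruct (join_axiom p P Q hPQ) as [k [hk _]]; eauto.
Qed.

Lemma line_through_eq P Q l :
  P <> Q -> on P l -> on Q l -> line_through P Q = l.
Proof.
intros hPQ h1 h2; destruct (line_through_spec P Q hPQ).
eapply line_eq; eauto.
Qed.

Lemma parallel_sym l m : parallel l m -> parallel m l.
Proof.
intros [h | h]; [left; auto | right].
intros [Q [h1 h2]]; apply h; eauto.
Qed.

Lemma parallel_through_spec P l :
  on P (parallel_through P l) /\ parallel (parallel_through P l) l.
Proof.
unfold parallel_through; apply epsilon_spec.
destruct (classic (on P l)) as [h | h].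
- exists l; split; [exact h | left; reflexivity].
- destruct (parallel_axiom p P l h) as [m [[h1 h2] _]].
  exists m; split; [exact h1 | right; exact h2].
Qed.

Lemma playfair P l m n :
  on P m -> on P n -> parallel m l -> parallel n l -> m = n.
Proof.
intros hm hn pm pn.
destruct (classic (on P l)) as [h | h].
- destruct pm as [-> | pm]; [| exfalso; eauto].
  destruct pn as [-> | pn]; [reflexivity | exfalso; eauto].
- destruct pm as [-> | pm]; [contradiction |].
  destruct pn as [-> | pn]; [contradiction |].
  destruct (parallel_axiom p P l h) as [k [_ hk]].
  rewrite <- (hk m), <- (hk n); auto.
Qed.

(* A canonical representative of the parallel class of [l]: parallelism becomes
   an equality, which [congruence] can handle. *)
Definition dir l : line p :=
  parallel_through (epsilon (point_inhabited p) (fun _ => True)) l.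

Lemma dir_parallel l m : dir l = dir m <-> parallel l m.
Proof.
unfold dir; set (b := epsilon _ _).
destruct (parallel_through_spec b l) as [bl pl].
destruct (parallel_through_spec b m) as [bm pm].
split.
- intros e; rewrite <- e in pm; apply parallel_sym in pl, pm.
  destruct (classic (exists P, on P l /\ on P m)) as [[P [h1 h2]] | h].
  + left; eapply playfair; eauto.
  + right; exact h.
- intros plm; eapply playfair; eauto.
  destruct (classic (exists P, on P (parallel_through b m) /\ on P l))
    as [[P [h1 h2]] | h]; [left | right; exact h].
  eapply playfair; eauto.
Qed.

Lemma dir_eq P l m : on P l -> on P m -> dir l = dir m -> l = m.
Proof.
intros hl hm e; apply dir_parallel in e.
eapply playfair; eauto; left; reflexivity.
Qed.

Lemma parallel_ex P l : exists m, on P m /\ dir m = dir l.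
Proof.
exists (parallel_through P l).
destruct (parallel_through_spec P l); split; auto; apply dir_parallel; auto.
Qed.

Lemma parallel_through_dir P l :
  on P (parallel_through P l) /\ dir (parallel_through P l) = dir l.
Proof. rewrite dir_parallel; apply parallel_through_spec. Qed.

Lemma meet_ex l m : dir l <> dir m -> exists X, on X l /\ on X m.
Proof.
intros h; apply NNPP; intros h'; apply h, dir_parallel; right; exact h'.
Qed.

Lemma point_eq l m X Y :
  l <> m -> on X l -> on X m -> on Y l -> on Y m -> X = Y.
Proof.
intros h h1 h2 h3 h4; apply NNPP; intros e.
apply h; eapply line_eq; eauto.
Qed.

Lemma meet_spec l m :
  dir l <> dir m -> on (meet l m) l /\ on (meet l m) m.
Proof. intros h; unfold meet; apply epsilon_spec, meet_ex, h. Qed.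

Lemma meet_eq l m X : dir l <> dir m -> on X l -> on X m -> meet l m = X.
Proof.
intros h hl hm; destruct (meet_spec l m h) as [h1 h2].
apply (point_eq l m); auto; congruence.
Qed.

Lemma off_ex l : exists R, ~ on R l.
Proof.
apply NNPP; intros h.
assert (h' : forall R, on R l) by (intros R; apply NNPP; eauto).
destruct (triangle_axiom p) as [A [B [C [_ [_ [_ hn]]]]]]; eauto.
Qed.

Lemma join_ex P Q : exists l, on P l /\ on Q l.
Proof.
destruct (classic (P = Q)) as [<- | h].
- exists (parallel_through P (epsilon (line_inhabited p) (fun _ => True))).
  split; apply parallel_through_spec.
- exists (line_through P Q); apply line_through_spec, h.
Qed.

(** Identifies lines that share a point and a direction, or two distinct points; [geo] then looks
    for a contradiction. *)
Ltac merge :=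
  repeat (subst; match goal with
  | H1 : on ?P ?l, H2 : on ?P ?m |- _ =>
    lazymatch l with m => fail | _ => idtac end;
    assert (l = m) by (apply (dir_eq P l m H1 H2); congruence); subst
  | H1 : on ?P ?l, H2 : on ?P ?m, H3 : on ?Q ?l, H4 : on ?Q ?m |- _ =>
    lazymatch l with m => fail | _ => idtac end;
    assert (l = m) by (apply (line_eq P Q l m); congruence); subst
  end).

Ltac geo := unfold not; intros; exfalso; merge; solve [congruence | contradiction].

Lemma dir_neq P Q k l :
  on P k -> on P l -> on Q k -> ~ on Q l -> dir k <> dir l.
Proof. geo. Qed.

(** The line [m] joining [P] to a point off [l] is not parallel to [l], so a parallel of [m]
    distinct from [m] meets [l], away from [P]. *)
Lemma second_point P l : on P l -> exists Q, Q <> P /\ on Q l.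
Proof.
intros hP; destruct (off_ex l) as [R hR].
destruct (join_ex P R) as [m [h1 h2]].
destruct (off_ex m) as [S hS].
destruct (parallel_ex S m) as [n [h3 h4]].
destruct (meet_ex l n) as [Q [h5 h6]]; [geo |].
exists Q; split; auto; geo.
Qed.

(** * Dilatations *)

(* PQ // RS; holds vacuously when P = Q or R = S. *)
Definition wpar P Q R S : Prop :=
  exists l m, on P l /\ on Q l /\ on R m /\ on S m /\ dir l = dir m.

Ltac wp := solve [match goal with
  | l : line p |- wpar _ _ _ _ =>
    exists l; match goal with m : line p |- _ =>
      exists m; repeat apply conj; first [assumption | congruence]
    end
  end].

Lemma wpar_diag_r P R S : wpar R S P P.
Proof.
destruct (join_ex R S) as [l [h1 h2]].
destruct (parallel_ex P l) as [m [h3 h4]]; wp.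
Qed.

Lemma wpar_swap P Q R S : wpar P Q R S -> wpar Q P S R.
Proof. intros [l [m [? [? [? [? ?]]]]]]; wp. Qed.

Lemma wpar_line P Q R S l m :
  wpar P Q R S -> P <> Q -> on P l -> on Q l -> on R m -> dir l = dir m ->
  on S m.
Proof. intros [l' [m' [? [? [? [? ?]]]]]] ? ? ? ? ?; merge; assumption. Qed.

(** Constant maps are included, so that the factor [O] has its homothety as well. *)
Definition dilatation (f : point p -> point p) : Prop :=
  forall X Y, wpar X Y (f X) (f Y).

Lemma dil_id : dilatation (fun X => X).
Proof. intros X Y; destruct (join_ex X Y) as [l [? ?]]; wp. Qed.

Lemma dil_const P : dilatation (fun _ => P).
Proof. intros X Y; apply wpar_diag_r. Qed.

Lemma dil_line f X Y l m :
  dilatation f -> on X l -> on Y l -> on (f X) m -> dir l = dir m ->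
  on (f Y) m.
Proof.
intros hf ? ? ? ?; destruct (classic (X = Y)) as [<- | h]; auto.
apply (wpar_line X Y (f X) (f Y) l m); auto.
Qed.

Lemma dil_comp f g :
  dilatation f -> dilatation g -> dilatation (fun X => f (g X)).
Proof.
intros hf hg X Y.
destruct (join_ex X Y) as [l [h1 h2]].
destruct (parallel_ex (g X) l) as [m [h3 h4]].
destruct (parallel_ex (f (g X)) l) as [n [h5 h6]].
assert (on (g Y) m) by (apply (dil_line g X Y l m); auto).
assert (on (f (g Y)) n) by
  (apply (dil_line f (g X) (g Y) m n); auto; congruence).
wp.
Qed.

(** For [X] off [PQ], the image of [X] is the intersection of the parallels to [PX] and [QX] through
    the images of [P] and [Q]. For [X] on [PQ], an auxiliary point [R] off the line replaces [Q]. *)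
Lemma dil_unique f g P Q :
  dilatation f -> dilatation g -> P <> Q -> f P = g P -> f Q = g Q ->
  forall X, f X = g X.
Proof.
intros hf hg.
assert (step : forall P Q X l, on P l -> on Q l -> ~ on X l -> P <> Q ->
  f P = g P -> f Q = g Q -> f X = g X).
{ clear P Q; intros P Q X l hP hQ hX hPQ eP eQ.
  destruct (join_ex P X) as [a [a1 a2]].
  destruct (join_ex Q X) as [b [b1 b2]].
  destruct (parallel_ex (f P) a) as [a' [a3 a4]].
  destruct (parallel_ex (f Q) b) as [b' [b3 b4]].
  assert (dir a <> dir b) by geo.
  apply (point_eq a' b'); [congruence | ..].
  - apply (dil_line f P X a); auto.
  - apply (dil_line f Q X b); auto.
  - apply (dil_line g P X a); auto; congruence.
  - apply (dil_line g Q X b); auto; congruence. }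
intros hPQ eP eQ X.
destruct (join_ex P Q) as [l [hP hQ]].
destruct (classic (on X l)) as [hX | hX]; [| eauto].
destruct (classic (P = X)) as [<- | hPX]; [auto |].
destruct (off_ex l) as [R hR].
destruct (join_ex P R) as [m [h1 h2]].
apply (step P R X m); auto; try geo.
apply (step P Q R l); auto.
Qed.

(** * Translations *)

(* The identity or a dilatation without fixed points. *)
Definition translation (f : point p -> point p) : Prop :=
  dilatation f /\ ((forall X, f X <> X) \/ (forall X, f X = X)).

Lemma trans_id : translation (fun X => X).
Proof. split; [apply dil_id | auto]. Qed.

(** Traces are parallel: [l] and the line [n] joining [X] to [f X] are mapped into themselves, so if
    they crossed, their common point would be fixed. *)
Lemma trans_line f P X l m :
  translation f -> on P l -> on (f P) l -> on X m -> dir l = dir m ->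
  on (f X) m.
Proof.
intros [hf [hfix | hid]] h1 h2 h3 h4; [| rewrite hid; auto].
assert (inv : forall Q k, on Q k -> on (f Q) k -> forall Y, on Y k -> on (f Y) k)
  by (intros Q k k1 k2 Y k3; apply (dil_line f Q Y k); auto).
destruct (join_ex X (f X)) as [n [n1 n2]].
destruct (classic (dir n = dir l)) as [e | e].
- assert (n = m) by (apply (dir_eq X); congruence); congruence.
- destruct (meet_ex n l e) as [Z [z1 z2]].
  exfalso; apply (hfix Z), (point_eq n l); eauto; congruence.
Qed.

(** For [R] off the line joining [P] to [f P], the image [f R] is the fourth vertex of a
    parallelogram on [P], [f P], [R]. So one value gives a second, and two determine a
    dilatation. *)
Lemma trans_unique f g P :
  translation f -> translation g -> f P = g P -> forall X, f X = g X.
Proof.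
intros hf hg e.
destruct (classic (P = f P)) as [eP | nP].
- destruct hf as [_ [hf | hf]]; [destruct (hf P); auto |].
  destruct hg as [_ [hg | hg]]; [destruct (hg P); congruence |].
  intros X; rewrite hf, hg; reflexivity.
- destruct (join_ex P (f P)) as [l [h1 h2]].
  destruct (off_ex l) as [R hR].
  destruct (join_ex P R) as [k [k1 k2]].
  destruct (parallel_ex R l) as [m [m1 m2]].
  destruct (parallel_ex (f P) k) as [n [n1 n2]].
  assert (P <> R) by congruence.
  apply (dil_unique f g P R); auto; [apply hf | apply hg |].
  assert (dir k <> dir l) by geo.
  apply (point_eq m n); [congruence | ..].
  + apply (trans_line f P R l); auto.
  + apply (dil_line f P R k); auto; apply hf.
  + apply (trans_line g P R l); auto; congruence.
  + apply (dil_line g P R k); auto; [apply hg | congruence].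
Qed.

(** The composite fixes [P], hence maps [PR] into itself, and it moves [R] only along the parallel
    to the trace of [P]; so [R] is fixed too. *)
Lemma trans_inv f g P :
  translation f -> translation g -> g (f P) = P -> forall X, g (f X) = X.
Proof.
intros hf hg e.
destruct (classic (P = f P)) as [eP | nP].
- destruct hf as [_ [hf | hf]]; [destruct (hf P); auto |].
  destruct hg as [_ [hg | hg]]; [destruct (hg P); congruence |].
  intros X; rewrite hg, hf; reflexivity.
- destruct (join_ex P (f P)) as [l [h1 h2]].
  destruct (off_ex l) as [R hR].
  destruct (join_ex P R) as [k [k1 k2]].
  destruct (parallel_ex R l) as [m [m1 m2]].
  destruct (parallel_ex (f P) k) as [n [n1 n2]].
  assert (P <> R) by congruence.
  assert (hgf : dilatation (fun X => g (f X)))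
    by (apply dil_comp; [apply hg | apply hf]).
  apply (dil_unique (fun X => g (f X)) (fun X => X) P R); auto using dil_id.
  assert (dir k <> dir l) by geo.
  apply (point_eq m k); auto; [congruence | ..].
  + apply (trans_line g (f P) (f R) l); auto; [congruence |].
    apply (trans_line f P R l); auto.
  + apply (dil_line (fun X => g (f X)) P R k); auto; congruence.
Qed.

Lemma trans_comp f g :
  translation f -> translation g -> translation (fun X => g (f X)).
Proof.
intros hf hg; split; [apply dil_comp; [apply hg | apply hf] |].
destruct (classic (exists P, g (f P) = P)) as [[P e] | h].
- right; eapply trans_inv; eauto.
- left; eauto.
Qed.

(** This is [h f h^-1 = g], written without an inverse because [h] may be constant. The sides of the
    parallelogram [P], [f P], [R], [f R] keep their directions under [h], so both composites send
    [R] to the intersection of [m'] and [n']. *)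
Lemma dil_trans h f g P :
  dilatation h -> translation f -> translation g ->
  g (h P) = h (f P) -> forall X, h (f X) = g (h X).
Proof.
intros hh hf hg e.
destruct (classic (exists R S, R <> S /\ h R = h S)) as [[R [S [n c]]] | inj].
{ assert (hc : forall X, h X = h R)
    by (apply (dil_unique h (fun _ => h R) R S); auto using dil_const).
  intros X; rewrite (hc X), (hc (f X)).
  rewrite (hc P), (hc (f P)) in e; auto. }
assert (inj' : forall R S, h R = h S -> R = S)
  by (intros R S c; apply NNPP; intros n; eauto).
destruct (classic (P = f P)) as [eP | nP].
{ destruct hf as [_ [hf | hf]]; [destruct (hf P); auto |].
  destruct hg as [_ [hg | hg]]; [destruct (hg (h P)); congruence |].
  intros X; rewrite hf, hg; reflexivity. }
destruct (join_ex P (f P)) as [l [h1 h2]].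
destruct (off_ex l) as [R hR].
destruct (join_ex P R) as [k [k1 k2]].
destruct (parallel_ex R l) as [m [m1 m2]].
destruct (parallel_ex (f P) k) as [n [n1 n2]].
destruct (parallel_ex (h P) l) as [l' [l1' l2']].
destruct (parallel_ex (h P) k) as [k' [k1' k2']].
destruct (parallel_ex (h R) m) as [m' [m1' m2']].
destruct (parallel_ex (h (f P)) n) as [n' [n1' n2']].
assert (P <> R) by congruence.
assert (dir k <> dir l) by geo.
assert (on (f R) m) by (apply (trans_line f P R l); auto).
assert (on (f R) n) by (apply (dil_line f P R k); auto; apply hf).
assert (on (h (f P)) l') by (apply (dil_line h P (f P) l); auto).
assert (on (h R) k') by (apply (dil_line h P R k); auto).
apply (dil_unique (fun X => h (f X)) (fun X => g (h X)) P R); auto;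
  try (apply dil_comp; auto; solve [apply hf | apply hg]).
apply (point_eq m' n'); [congruence | ..].
- apply (dil_line h R (f R) m); auto.
- apply (dil_line h (f P) (f R) n); auto.
- apply (trans_line g (h P) (h R) l'); auto; congruence.
- apply (dil_line g (h P) (h R) k'); auto; [apply hg | |]; congruence.
Qed.

(** * Construction of dilatations from Desargues' axiom *)

(* A pencil is the set of lines through a point or a parallel class.  Treating
   both at once constructs homotheties and translations by a single argument. *)
Definition pencil (L : line p -> Prop) : Prop :=
  (exists O, forall l, L l <-> on O l) \/
  (exists d, forall l, L l <-> dir l = dir d).

Lemma pencil_ex L X : pencil L -> exists l, L l /\ on X l.
Proof.
intros [[O h] | [d h]].
- destruct (join_ex O X) as [l [? ?]]; exists l; rewrite h; auto.
- destruct (parallel_ex X d) as [l [? ?]]; exists l; rewrite h; auto.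
Qed.

(** Distinct members of a pencil can meet only in its centre; in a parallel class they never
    meet. *)
Lemma pencil_center L l m n X :
  pencil L -> L l -> L m -> L n -> l <> m -> on X l -> on X m -> on X n.
Proof.
intros [[O h] | [d h]]; rewrite !h; intros.
- rewrite (point_eq l m X O); auto.
- destruct H2; apply (dir_eq X); congruence.
Qed.

(** Extends Desargues' axiom to a second triangle that may degenerate or share vertices with the
    first. *)
Lemma desargues_pencil (hDes : Desargues p) L a b c A B C A' B' C' :
  pencil L -> L a -> L b -> L c -> a <> b -> a <> c -> b <> c ->
  on A a -> on A' a -> on B b -> on B' b -> on C c -> on C' c ->
  ~ on A b -> ~ on A c -> ~ on B a -> ~ on B c -> ~ on C a -> ~ on C b ->
  wpar A B A' B' -> wpar B C B' C' -> wpar A C A' C'.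
Proof.
intros hL La Lb Lc nab nac nbc hA hA' hB hB' hC hC' Ab Ac Ba Bc Ca Cb wAB wBC.
assert (nAB : A <> B) by congruence.
assert (nBC : B <> C) by congruence.
assert (nAC : A <> C) by congruence.
destruct wAB as [k [k' [k1 [k2 [k3 [k4 k5]]]]]].
destruct wBC as [j [j' [j1 [j2 [j3 [j4 j5]]]]]].
destruct (join_ex A C) as [i [i1 i2]].
destruct (join_ex A' C') as [i' [i1' i2']].
(* If [A'] and [B'] coincide, they are the centre, and [BC] parallel to [B'C'] forces [C'] there
   too. *)
destruct (classic (A' = B')) as [eAB | nAB'].
{ assert (B' = C') as <- by (apply NNPP; intro;
    assert (on B' c) by (apply (pencil_center L a b c); congruence); geo).
  subst; apply wpar_diag_r. }
destruct (classic (B' = C')) as [eBC | nBC'].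
{ exfalso; assert (on B' a) by (apply (pencil_center L b c a); congruence); geo. }
destruct (classic (A' = C')) as [<- | nAC']; [apply wpar_diag_r |].
destruct (classic (A = A')) as [<- | nAA].
{ assert (B = B') as <- by (apply NNPP; geo).
  assert (C = C') as <- by (apply NNPP; geo); wp. }
assert (nBB : B <> B') by geo.
assert (nCC : C <> C') by geo.
assert (A'b : ~ on A' b).
{ intro; assert (on A' c) by (apply (pencil_center L a b c); congruence); geo. }
assert (C'b : ~ on C' b).
{ intro; assert (on C' a) by (apply (pencil_center L b c a); congruence); geo. }
assert (A'c : ~ on A' c).
{ intro; apply A'b; apply (pencil_center L a c b); congruence. }
assert (C'a : ~ on C' a).
{ intro; apply C'b; apply (pencil_center L a c b); congruence. }
assert (nib : i <> b) by congruence.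
assert (nib' : i' <> b) by congruence.
assert (ni : i <> i') by geo.
pose proof (hDes A B C A' B' C') as D.
rewrite (line_through_eq A A' a), (line_through_eq B B' b),
  (line_through_eq C C' c), (line_through_eq A C i), (line_through_eq A' C' i'),
  (line_through_eq A B k), (line_through_eq A' B' k'), (line_through_eq B C j),
  (line_through_eq B' C' j') in D by auto.
exists i, i'; repeat apply conj; auto.
apply dir_parallel; apply D; auto.
- repeat constructor; simpl; intuition congruence.
- destruct hL as [[O h] | [d h]]; rewrite !h in *; [right; eauto | left].
  rewrite <- !dir_parallel; repeat split; congruence.
- apply dir_parallel; auto.
- apply dir_parallel; auto.
- geo.
- geo.
Qed.

(** A point [X] off [l0] moves along its pencil line to the parallel of [IX] through [A]. Points of
    [l0] follow the same rule with a point [R] off [l0] and its image in place of [I] and [A].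
    Desargues' axiom then compares any two points. *)
Lemma pencil_dilatation (hDes : Desargues p) L l0 I A :
  pencil L ->
  (forall l m, L l -> L m -> exists X, ~ on X l /\ ~ on X m) ->
  L l0 -> on I l0 -> on A l0 ->
  (forall m, L m -> on I m -> m = l0) ->
  exists f, dilatation f /\ f I = A /\
    forall X l, L l -> on X l -> on (f X) l.
Proof.
intros hL third L0 hI hA uI.
assert (off_l0 : forall X l m, ~ on X l0 -> L l -> L m -> on X l -> on X m -> l = m).
{ intros X l m ? ? ? ? ?; apply NNPP; intro.
  assert (on X l0) by (apply (pencil_center L l m l0); auto); contradiction. }
assert (exoff : forall X, ~ on X l0 -> exists Y,
  (forall m, L m -> on X m -> on Y m) /\ wpar I X A Y).
{ intros X hX; destruct (pencil_ex L X hL) as [l [Ll Xl]].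
  destruct (join_ex I X) as [n [n1 n2]].
  destruct (parallel_ex A n) as [n' [n3 n4]].
  assert (dir n' <> dir l).
  { intro; assert (n = l) by (apply (dir_eq X); congruence); subst n.
    rewrite (uI l) in Xl; auto. }
  destruct (meet_ex n' l) as [Y [y1 y2]]; auto.
  exists Y; split; [| wp].
  intros m Lm Xm; rewrite (off_l0 X m l); auto. }
destruct (off_ex l0) as [R hR].
destruct (pencil_ex L R hL) as [r [Lr Rr]].
destruct (exoff R hR) as [R' [hR1 hR2]].
assert (R'r : on R' r) by auto.
assert (exon : forall X, on X l0 -> exists Y, on Y l0 /\ wpar R X R' Y).
{ intros X hX; destruct (join_ex R X) as [n [n1 n2]].
  destruct (parallel_ex R' n) as [n' [n3 n4]].
  assert (dir n <> dir l0) by geo.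
  destruct (meet_ex n' l0) as [Y [y1 y2]]; [congruence |].
  exists Y; split; auto; wp. }
destruct (functional_choice (fun X Y =>
  (~ on X l0 -> (forall m, L m -> on X m -> on Y m) /\ wpar I X A Y) /\
  (on X l0 -> on Y l0 /\ wpar R X R' Y))) as [f hf].
{ intros X; destruct (classic (on X l0)) as [hX | hX].
  - destruct (exon X hX) as [Y hY]; exists Y; tauto.
  - destruct (exoff X hX) as [Y hY]; exists Y; tauto. }
assert (foff : forall X l, ~ on X l0 -> L l -> on X l -> on (f X) l)
  by (intros X l hX; apply (hf X); auto).
assert (foffw : forall X, ~ on X l0 -> wpar I X A (f X))
  by (intros X hX; apply (hf X); auto).
assert (fon : forall X, on X l0 -> on (f X) l0)
  by (intros X hX; apply (hf X); auto).
assert (fonw : forall X, on X l0 -> wpar R X R' (f X))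
  by (intros X hX; apply (hf X); auto).
assert (nr : r <> l0) by congruence.
(* Choice gives [f] only through the two relations; they determine its values at [R] and [I]. *)
assert (fR : f R = R').
{ destruct (join_ex I R) as [n [n1 n2]].
  destruct (parallel_ex A n) as [n' [n3 n4]].
  assert (I <> R) by congruence.
  apply (point_eq n' r); auto.
  - intro; subst n'; assert (n = r) by (apply (dir_eq R); congruence).
    subst n; apply nr; auto.
  - apply (wpar_line I R A (f R) n n'); auto.
  - apply (wpar_line I R A R' n n'); auto. }
assert (fI : f I = A).
{ destruct (join_ex R I) as [n [n1 n2]].
  destruct (parallel_ex R' n) as [n' [n3 n4]].
  assert (R <> I) by congruence.
  assert (dir n <> dir l0) by geo.
  apply (point_eq n' l0); auto; [congruence | ..].
  - apply (wpar_line R I R' (f I) n n'); auto.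
  - apply (wpar_line R I R' A n n'); auto; apply wpar_swap; auto. }
assert (fL : forall X l, L l -> on X l -> on (f X) l).
{ intros X l Ll Xl; destruct (classic (on X l0)) as [hX | hX]; auto.
  destruct (classic (l = l0)) as [-> | nl]; auto.
  assert (Xr : on X r) by (apply (pencil_center L l l0 r); auto).
  assert (R <> X) by congruence.
  assert (on (f X) r) by (apply (wpar_line R X R' (f X) r r); auto).
  rewrite (point_eq r l0 (f X) X); auto. }
exists f; repeat split; auto.
(* Desargues with middle vertex [I], whose two sides are parallel to their images by
   construction. *)
assert (off_off : forall X Z, ~ on X l0 -> ~ on Z l0 -> wpar X Z (f X) (f Z)).
{ intros X Z hX hZ.
  destruct (pencil_ex L X hL) as [a [La Xa]].
  destruct (pencil_ex L Z hL) as [c [Lc Zc]].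
  assert (on (f X) a) by auto.
  assert (on (f Z) c) by auto.
  destruct (classic (a = c)) as [<- | nac]; [wp |].
  apply (desargues_pencil hDes L a l0 c X I Z (f X) A (f Z)); auto;
    try congruence.
  - intro; eauto.
  - intro; rewrite (uI a) in Xa; auto.
  - intro; rewrite (uI c) in Zc; auto.
  - intro; eauto.
  - apply wpar_swap; auto. }
(* Now the middle vertex is [S]: one of its sides is the hypothesis, the other comes from
   [off_off]. *)
assert (on_off' : forall X S Z s c, on X l0 -> ~ on S l0 -> ~ on Z l0 ->
  L s -> L c -> on S s -> on Z c -> s <> c -> ~ on X c ->
  wpar X S (f X) (f S) -> wpar X Z (f X) (f Z)).
{ intros X S Z s c hX hS hZ Ls Lc Ss Zc nsc Xc w.
  apply (desargues_pencil hDes L l0 s c X S Z (f X) (f S) (f Z)); auto;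
    try congruence.
  - intro; apply Xc; apply (pencil_center L l0 s c); auto; congruence.
  - intro; eauto.
  - intro; eauto. }
assert (on_off : forall X Z, on X l0 -> ~ on Z l0 -> wpar X Z (f X) (f Z)).
{ intros X Z hX hZ.
  destruct (pencil_ex L Z hL) as [c [Lc Zc]].
  destruct (classic (on X c)) as [Xc | Xc].
  { assert (on (f X) c) by auto; assert (on (f Z) c) by auto; wp. }
  assert (wR : wpar X R (f X) (f R))
    by (rewrite fR; apply wpar_swap; auto).
  destruct (classic (r = c)) as [<- | nrc].
  (* [R] and [Z] share the pencil line [r], so the comparison passes from [R] to some [S] off [l0]
     and [r], then from [S] to [Z]. *)
  - destruct (third l0 r) as [S [S0 Sr]]; auto.
    destruct (pencil_ex L S hL) as [s [Ls Ss]].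
    assert (~ on X s).
    { intro; apply Xc; apply (pencil_center L l0 s r); auto; congruence. }
    apply (on_off' X S Z s r); auto; [congruence |].
    apply (on_off' X R S r s); auto; congruence.
  - apply (on_off' X R Z r c); auto. }
intros X Z; destruct (classic (on X l0)) as [hX | hX];
  destruct (classic (on Z l0)) as [hZ | hZ]; auto.
- assert (on (f X) l0) by auto; assert (on (f Z) l0) by auto; wp.
- apply wpar_swap; auto.
Qed.

(** * Existence of homotheties and translations *)

Lemma homothety_ex (hDes : Desargues p) O I l A :
  O <> I -> on O l -> on I l -> on A l ->
  exists f, dilatation f /\ f O = O /\ f I = A.
Proof.
intros hOI Ol Il Al.
destruct (pencil_dilatation hDes (on O) l I A) as [f [f1 [f2 f3]]]; auto.
- left; exists O; tauto.
- intros a b Oa Ob; destruct (classic (a = b)) as [<- | nab].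
  + destruct (off_ex a) as [X hX]; eauto.
  (* [X] will be the fourth vertex of the parallelogram on [O], [Q], [P], available even when lines
     have only two points. *)
  + destruct (second_point O a Oa) as [P [P1 P2]].
    destruct (second_point O b Ob) as [Q [Q1 Q2]].
    destruct (join_ex P Q) as [k [k1 k2]].
    destruct (parallel_ex O k) as [k' [k3 k4]].
    destruct (parallel_ex P b) as [m [m1 m2]].
    assert (dir k <> dir b) by geo.
    destruct (meet_ex k' m) as [X [x1 x2]]; [congruence |].
    assert (X <> O) by geo.
    exists X; split; geo.
- intros m Om Im; apply (line_eq O I); auto.
- exists f; repeat split; auto.
  destruct (off_ex l) as [R hR]; destruct (join_ex O R) as [m [m1 m2]].
  apply (point_eq l m); auto; congruence.
Qed.

(** Each of the two parallels contains at most one point of a transversal, so a transversal with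
    three points leaves one over. If [l] itself has their direction, the points [O], [R], [K] of
    [OR] serve, with [KJ] parallel to [RI]. *)
Lemma three_parallels O I J l :
  O <> I -> O <> J -> I <> J -> on O l -> on I l -> on J l ->
  forall a b, dir a = dir b -> exists X, ~ on X a /\ ~ on X b.
Proof.
assert (transversal : forall O I J l, O <> I -> O <> J -> I <> J ->
  on O l -> on I l -> on J l ->
  forall a b, dir a = dir b -> dir a <> dir l ->
  exists X, ~ on X a /\ ~ on X b).
{ clear; intros O I J l OI OJ IJ hO hI hJ a b ab al.
  assert (oa : forall P Q, on P l -> on Q l -> on P a -> on Q a -> P = Q)
    by (intros; apply (point_eq a l); congruence).
  assert (ob : forall P Q, on P l -> on Q l -> on P b -> on Q b -> P = Q)
    by (intros; apply (point_eq b l); congruence).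
  apply NNPP; intros h.
  assert (c : forall X, on X a \/ on X b).
  { intros X; apply NNPP; intros c; apply h; exists X; tauto. }
  destruct (c O), (c I), (c J); eauto. }
intros OI OJ IJ hO hI hJ a b ab.
destruct (classic (dir a = dir l)) as [al | al]; [| eauto].
destruct (off_ex l) as [R hR].
destruct (join_ex O R) as [k [k1 k2]].
destruct (join_ex I R) as [i [i1 i2]].
destruct (parallel_ex J i) as [j [j1 j2]].
assert (dir k <> dir i) by geo.
destruct (meet_ex k j) as [K [K1 K2]]; [congruence |].
apply (transversal O R K k); auto; try geo.
Qed.

Lemma translation_ex (hDes : Desargues p) P Q :
  (forall a b, dir a = dir b -> exists X, ~ on X a /\ ~ on X b) ->
  exists f, translation f /\ f P = Q.
Proof.
intros third.
destruct (classic (P = Q)) as [<- | nPQ].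
{ exists (fun X => X); split; auto using trans_id. }
destruct (join_ex P Q) as [l [Pl Ql]].
destruct (pencil_dilatation hDes (fun m => dir m = dir l) l P Q)
  as [f [f1 [f2 f3]]]; auto.
- right; exists l; tauto.
- intros; apply third; congruence.
- intros m ? ?; apply (dir_eq P); auto.
- exists f; split; auto; split; auto; left.
  (* A fixed point [X] off [l] would make [PX] invariant and so put [Q] on it. *)
  assert (foff : forall X, ~ on X l -> f X <> X).
  { intros X hX e; destruct (join_ex P X) as [n [n1 n2]].
    assert (on (f P) n) by (apply (dil_line f X P n n); auto; congruence).
    rewrite f2 in *; geo. }
  intros X e; destruct (classic (on X l)) as [hX | hX]; [| eapply foff; eauto].
  (* A fixed point on [l] would force [R] to be fixed, its image lying on [XR] and on the parallel
     to [l]. *)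
  destruct (off_ex l) as [R hR]; specialize (foff R hR).
  destruct (join_ex X R) as [n [n1 n2]].
  destruct (parallel_ex R l) as [m [m1 m2]].
  assert (on (f R) m) by auto.
  assert (on (f R) n) by (apply (dil_line f X R n n); auto; congruence).
  geo.
Qed.

(** * Sum and product as values of translations and homotheties *)

Lemma padd_trans (O I A B : point p) f :
  O <> I -> on A (line_through O I) -> on B (line_through O I) ->
  translation f -> f O = A -> padd O I A B = f B.
Proof.
intros hOI hA hB hf fO; unfold padd.
destruct (line_through_spec O I hOI) as [hO hI].
(* [epsilon] hides the auxiliary point chosen; the argument works for any [B1] off [OI]. *)
match goal with |- epsilon ?i ?P = _ =>
  destruct (epsilon_spec i P) as [B1 [hB1 ->]] end.
{ destruct (off_ex (line_through O I)) as [R hR]; eauto. }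
unfold add_via; set (l := line_through O I) in *.
assert (n1 : O <> B1) by congruence.
assert (n2 : B <> B1) by congruence.
destruct (line_through_spec _ _ n1) as [a1 a2].
destruct (line_through_spec _ _ n2) as [b1 b2].
set (a := line_through O B1) in *; set (b := line_through B B1) in *.
destruct (parallel_through_dir B1 l) as [c1 c2].
destruct (parallel_through_dir A a) as [d1 d2].
set (c := parallel_through B1 l) in *; set (d := parallel_through A a) in *.
assert (dir a <> dir l) by (apply (dir_neq O B1); auto).
assert (dir b <> dir l) by (apply (dir_neq B B1); auto).
assert (on (f O) l) by congruence.
(* [c] is parallel to the trace of [O] and so contains [f B1]; [d] contains the image of the line
   [OB1]. *)
assert (e : meet c d = f B1).
{ apply meet_eq; [congruence | ..].
  - apply (trans_line f O B1 l); auto.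
  - apply (dil_line f O B1 a); auto; [apply hf | congruence]. }
rewrite e; destruct (parallel_through_dir (f B1) b) as [e1 e2].
apply meet_eq; [congruence | ..].
- apply (dil_line f B1 B b); auto; apply hf.
- apply (trans_line f O B l); auto.
Qed.

Lemma pmul_dil (O I A B : point p) f :
  O <> I -> on A (line_through O I) -> on B (line_through O I) ->
  dilatation f -> f O = O -> f I = A -> pmul O I A B = f B.
Proof.
intros hOI hA hB hf fO fI; unfold pmul.
destruct (line_through_spec O I hOI) as [hO hI].
match goal with |- epsilon ?i ?P = _ =>
  destruct (epsilon_spec i P) as [B1 [hB1 ->]] end.
{ destruct (off_ex (line_through O I)) as [R hR]; eauto. }
unfold mul_via; set (l := line_through O I) in *.
assert (n1 : O <> B1) by congruence.
assert (n2 : B <> B1) by congruence.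
assert (n3 : I <> B1) by congruence.
destruct (line_through_spec _ _ n1) as [a1 a2].
destruct (line_through_spec _ _ n2) as [b1 b2].
destruct (line_through_spec _ _ n3) as [c1 c2].
set (a := line_through O B1) in *; set (b := line_through B B1) in *.
set (c := line_through I B1) in *.
assert (dir c <> dir a).
{ apply (dir_neq B1 I); auto; intro.
  apply hB1; rewrite <- (line_eq O I a l); auto. }
assert (dir b <> dir l) by (apply (dir_neq B B1); auto).
destruct (parallel_through_dir A c) as [d1 d2].
set (d := parallel_through A c) in *.
(* [f] maps [IB1] into its parallel through [A], and [OB1] into itself. *)
assert (e : meet d a = f B1).
{ apply meet_eq; [congruence | ..].
  - apply (dil_line f I B1 c); auto; congruence.
  - apply (dil_line f O B1 a); auto; congruence. }
rewrite e; destruct (parallel_through_dir (f B1) b) as [e1 e2].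
apply meet_eq; [congruence | ..].
- apply (dil_line f B1 B b); auto.
- apply (dil_line f O B l); auto; congruence.
Qed.

Lemma pmul_on (hDes : Desargues p) (O I A B : point p) :
  O <> I -> on A (line_through O I) -> on B (line_through O I) ->
  on (pmul O I A B) (line_through O I).
Proof.
intros hOI hA hB; destruct (line_through_spec O I hOI) as [hO hI].
destruct (homothety_ex hDes O I _ A hOI hO hI hA) as [f [f1 [f2 f3]]].
rewrite (pmul_dil O I A B f); auto.
apply (dil_line f O B (line_through O I)); auto; congruence.
Qed.

(** Read off from the last intersection, without translations, so that it also serves when lines
    have two points. *)
Lemma padd_on (O I A B : point p) :
  O <> I -> on B (line_through O I) -> on (padd O I A B) (line_through O I).
Proof.
intros hOI hB; unfold padd.
match goal with |- on (epsilon ?i ?P) _ =>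
  destruct (epsilon_spec i P) as [B1 [hB1 ->]] end.
{ destruct (off_ex (line_through O I)) as [R hR]; eauto. }
unfold add_via; refine (proj2 (meet_spec _ _ _)).
rewrite (proj2 (parallel_through_dir _ _)).
assert (n : B <> B1) by congruence.
destruct (line_through_spec B B1 n); apply (dir_neq B B1); auto.
Qed.

(** Covers the unspecified value as well, so a cross-ratio containing an inverse of [O] still lies
    on [OI]. *)
Lemma choose_on_on l (good : point p -> Prop) Y : on Y l -> on (choose_on l good) l.
Proof.
intros hY; unfold choose_on.
match goal with |- on (epsilon ?i ?P) _ =>
  destruct (epsilon_spec i P) as [h _]; auto end.
destruct (classic (exists X, on X l /\ good X)) as [[X [h1 h2]] | h].
- exists X; auto.
- exists Y; tauto.
Qed.

Lemma cross_ratio_on (hDes : Desargues p) (O I A B C D : point p) :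
  O <> I -> on (cross_ratio O I A B C D) (line_through O I).
Proof.
intros hOI; destruct (line_through_spec O I hOI) as [hO hI].
unfold cross_ratio, psub, popp, pinv.
repeat first [apply pmul_on | apply padd_on | apply (choose_on_on _ _ O)];
  auto.
Qed.

(** * The two distributive laws *)

Section Distributivity.

Variables O I : point p.
Hypotheses (hDes : Desargues p) (hOI : O <> I).
Hypothesis third : forall a b, dir a = dir b -> exists X, ~ on X a /\ ~ on X b.

Lemma pmul_addr x y z :
  on x (line_through O I) -> on y (line_through O I) -> on z (line_through O I) ->
  pmul O I x (padd O I y z) = padd O I (pmul O I x y) (pmul O I x z).
Proof.
intros hx hy hz; destruct (line_through_spec O I hOI) as [hO hI].
destruct (homothety_ex hDes O I _ x hOI hO hI hx) as [h [h1 [h2 h3]]].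
destruct (translation_ex hDes O y third) as [f [f1 f2]].
destruct (translation_ex hDes O (h y) third) as [g [g1 g2]].
rewrite (pmul_dil O I x (padd O I y z) h), (padd_trans O I y z f) by
  auto using padd_on.
rewrite (padd_trans O I _ _ g), (pmul_dil O I x z h) by
  (auto using pmul_on; symmetry; rewrite g2; apply pmul_dil; auto).
(* The claim is now [h (f z) = g (h z)], and at [O] both sides are [h y]. *)
apply (dil_trans h f g O); auto; congruence.
Qed.

Lemma pmul_addl x y z :
  on x (line_through O I) -> on y (line_through O I) -> on z (line_through O I) ->
  pmul O I (padd O I x y) z = padd O I (pmul O I x z) (pmul O I y z).
Proof.
intros hx hy hz; destruct (line_through_spec O I hOI) as [hO hI].
destruct (homothety_ex hDes O I _ x hOI hO hI hx) as [h [h1 [h2 h3]]].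
destruct (homothety_ex hDes O I _ y hOI hO hI hy) as [k [k1 [k2 k3]]].
destruct (functional_choice (fun P (f : point p -> point p) =>
  translation f /\ f O = P)) as [t ht].
{ intros P; apply translation_ex; auto. }
set (f X := t (h X) (k X)).
(* With [s] the translation taking [h Y] to [h X], [f X] is [s (t (h Y) (k X))]. The inner map is a
   dilatation in [X] with value [f Y] at [Y], and [s] moves points parallel to [XY]. *)
assert (hf : dilatation f).
{ intros X Y.
  destruct (translation_ex hDes (h Y) (h X) third) as [s [s1 s2]].
  assert (e : forall W, s (t (h Y) W) = t (h X) W).
  { apply (trans_unique (fun W => s (t (h Y) W)) _ O).
    - apply trans_comp; auto; apply ht.
    - apply ht.
    - rewrite (proj2 (ht (h Y))), s2; symmetry; apply ht. }
  destruct (join_ex X Y) as [l [Xl Yl]].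
  destruct (parallel_ex (f Y) l) as [m [m1 m2]].
  destruct (parallel_ex (h Y) l) as [n [n1 n2]].
  assert (on (f X) m).
  { unfold f; rewrite <- e; apply (trans_line s (h Y) _ n); auto; try congruence.
    - rewrite s2; apply (dil_line h Y X l); auto.
    - apply (dil_line (fun W => t (h Y) (k W)) Y X l); auto.
      apply dil_comp; auto; apply ht. }
  wp. }
rewrite (padd_trans O I (pmul O I x z) _ (t (h z))), (pmul_dil O I y z k) by
  (auto using pmul_on; try apply ht; symmetry;
   rewrite (proj2 (ht _)); apply pmul_dil; auto).
(* [f] fixes [O] and sends [I] to [x + y], so it is the homothety of that factor, while [f z] is the
   sum of the two products. *)
apply (pmul_dil O I _ z f); auto using padd_on; unfold f.
- rewrite h2, k2; apply ht.
- rewrite h3, k3; symmetry; apply padd_trans; auto; apply ht.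
Qed.

End Distributivity.

(** * Values at [O] and [I], and the conclusion *)

(** With [padd00], these values settle distributivity when [O] and [I] are the only points of
    [OI]. *)
Lemma pmul_simpl (hDes : Desargues p) (O I A : point p) :
  O <> I -> on A (line_through O I) ->
  pmul O I O A = O /\ pmul O I A O = O /\ pmul O I I A = A /\ pmul O I A I = A.
Proof.
intros hOI hA; destruct (line_through_spec O I hOI) as [hO hI].
destruct (homothety_ex hDes O I _ A hOI hO hI hA) as [h [h1 [h2 h3]]].
repeat split.
- apply (pmul_dil O I O A (fun _ => O)); auto using dil_const.
- rewrite (pmul_dil O I A O h); auto.
- apply (pmul_dil O I I A (fun X => X)); auto using dil_id.
- rewrite (pmul_dil O I A I h); auto.
Qed.

Lemma padd00 (O I : point p) : O <> I -> padd O I O O = O.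
Proof.
intros hOI; destruct (line_through_spec O I hOI) as [hO hI].
apply (padd_trans O I O O (fun X => X)); auto using trans_id.
Qed.

End Plane.

Theorem theorem3 (p : affine_plane) (hDes : Desargues p)
  (O I : point p) (hOI : O <> I)
  (B C D : point p)
  (hB : on B (line_through O I))
  (hC : on C (line_through O I))
  (hD : on D (line_through O I))
  (x y z : point p)
  (hx : R4A O I B C D x) (hy : R4A O I B C D y) (hz : R4A O I B C D z) :
  x *[O, I] (y +[O, I] z) = (x *[O, I] y) +[O, I] (x *[O, I] z)
  /\
  (x +[O, I] y) *[O, I] z = (x *[O, I] z) +[O, I] (y *[O, I] z).
Proof.
assert (on_line : forall M, R4A O I B C D M -> on M (line_through O I)).
{ intros M [X [_ ->]]; apply cross_ratio_on; auto. }
apply on_line in hx, hy, hz; clear on_line.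
destruct (line_through_spec p O I hOI) as [hO hI].
destruct (classic (exists J, on J (line_through O I) /\ O <> J /\ I <> J))
  as [[J [hJ [nO nI]]] | two].
- pose proof (three_parallels p O I J _ hOI nO nI hO hI hJ) as third.
  split; [apply pmul_addr | apply pmul_addl]; auto.
- (* The plane of order 2 has only two lines in each direction, so the
     construction of translations fails; but OI = {O, I}. *)
  assert (OorI : forall J, on J (line_through O I) -> J = O \/ J = I).
  { intros J hJ; apply NNPP; intro n; apply two; exists J; repeat split; auto. }
  pose proof (pmul_simpl p hDes O I) as s.
  pose proof (padd_on p O I) as a.
  pose proof (padd00 p O I hOI) as e.
  (* The common factor is [O] or [I]: for [O] both sides become [O], for [I] the products reduce to
     their other factors. *)
  split.
  + destruct (s (padd O I y z)) as [s1 [_ [s2 _]]]; auto.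
    destruct (s y) as [s3 [_ [s4 _]]]; auto.
    destruct (s z) as [s5 [_ [s6 _]]]; auto.
    destruct (OorI x hx); subst x; congruence.
  + destruct (s (padd O I x y)) as [_ [s1 [_ s2]]]; auto.
    destruct (s x) as [_ [s3 [_ s4]]]; auto.
    destruct (s y) as [_ [s5 [_ s6]]]; auto.
    destruct (OorI z hz); subst z; congruence.
Qed.
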